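(* Let real-valued random variables be generated by $$X = qA + E_X,\qquad H = bA + E_H,\qquad Y = cX + dH + E_Y,$$ where $A, E_X, E_H, E_Y$ are mutually independent, $A$ has a density $p_A$, and $q,b,c,d\in\mathbb{R}$ are constants ($H$ is unobserved). Let $E := E_Y + dE_H$, and for constants $\alpha\in\mathbb{R}$ and $\beta\neq 0$ let $\widehat{Y} := \alpha A + \beta X$. Assume $c\neq 0$ and $qc+bd\neq 0$. Assume the densities $p_{E_X}$ and $p_E$ are positive on all of $\mathbb{R}$, and that $f_2:=\log p_{E_X}$ and $f_3:=\log p_E$ are three times differentiable. If at most one of $E_X$ and $E$ is Gaussian, then $\widehat{Y}$ is not conditionally independent of $A$ given $Y$ (for every such choice of $\alpha$ and $\beta\ne 0$).
   Context: Conditional independence of $U$ and $V$ given $W$ is written $U \perp V \mid W$. The statement ''$\widehat{Y}\perp A\mid Y$'' is the Equalized Odds fairness criterion for the predictor $\widehat{Y}$, the protected feature $A$ and the target $Y$. *)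

(* Defs.v *)
From HB Require Import structures.
From mathcomp Require Import all_boot all_order all_algebra.
From mathcomp Require Import all_classical all_reals all_analysis.
Set Implicit Arguments. Unset Strict Implicit. Unset Printing Implicit Defensive.
Import Order.TTheory GRing.Theory Num.Theory.
Import numFieldNormedType.Exports.
Local Open Scope classical_set_scope.
Local Open Scope ring_scope.

Section defs.
Context {d : measure_display} {T : measurableType d} {R : realType}.
Variable P : probability T R.

(* Mutual independence of four real random variables: the joint law is the
   product of the marginals on measurable rectangles (taking some B_i = setT
   gives the product rule for every subfamily). *)
Definition mutually_independent4 (X1 X2 X3 X4 : T -> R) : Prop :=
  forall B1 B2 B3 B4 : set R,
    measurable B1 -> measurable B2 -> measurable B3 -> measurable B4 ->
    P (X1 @^-1` B1 `&` X2 @^-1` B2 `&` X3 @^-1` B3 `&` X4 @^-1` B4) =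
    (P (X1 @^-1` B1) * P (X2 @^-1` B2) * P (X3 @^-1` B3) * P (X4 @^-1` B4))%E.

Definition has_density (X : T -> R) (p : R -> R) : Prop :=
  measurable_fun setT p /\ (forall x, 0 <= p x) /\
  forall B : set R, measurable B ->
    P (X @^-1` B) = (\int[lebesgue_measure]_(x in B) (p x)%:E)%E.

Definition gaussian_pdf (m s : R) (x : R) : R :=
  (s * Num.sqrt (2 * pi))^-1 * expR (- ((x - m) ^+ 2) / (2 * s ^+ 2)).

Definition is_gaussian (X : T -> R) : Prop :=
  exists m s : R, 0 < s /\ has_density X (gaussian_pdf m s).

(* g o W is a version of the conditional probability P(S | W). *)
Definition is_cond_prob (S : set T) (W : T -> R) (g : R -> R) : Prop :=
  measurable_fun setT g /\
  forall C : set R, measurable C ->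
    P (S `&` W @^-1` C) = (\int[P]_(t in W @^-1` C) (g (W t))%:E)%E.

(* Conditional independence U _||_ V | W:
   P(U in B1, V in B2 | W) = P(U in B1 | W) P(V in B2 | W) a.s.,
   for all Borel B1, B2 (conditional probabilities given W written, by
   Doob--Dynkin, as g(W) with g Borel). *)
Definition cond_indep (U V W : T -> R) : Prop :=
  forall B1 B2 : set R, measurable B1 -> measurable B2 ->
    exists g1 g2 : R -> R,
      is_cond_prob (U @^-1` B1) W g1 /\
      is_cond_prob (V @^-1` B2) W g2 /\
      is_cond_prob (U @^-1` B1 `&` V @^-1` B2) W (fun w => g1 w * g2 w).

Definition thrice_differentiable (f : R -> R) : Prop :=
  forall (n : nat) (x : R), (n < 3)%N -> derivable (derive1n n f) x 1.

End defs.

(* Main.v *)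
Require Import Defs.
From HB Require Import structures.
From mathcomp Require Import all_boot all_order all_algebra.
From mathcomp Require Import all_classical all_reals all_analysis.
From mathcomp Require Import measurable_realfun ring lra.
Import Order.TTheory GRing.Theory Num.Theory.
Import numFieldNormedType.Exports.
Local Open Scope classical_set_scope.
Local Open Scope ring_scope.

(* Put k = qc + bd, s = alpha/beta + q and V = sA + E_X, so that Yhat = beta V
   and Y = kA + cE_X + E.  Given A = a, the pair (V, Y) has log-density
     F(a, w, y) = f2(w - sa) + f3(y - ka - c(w - sa)).
   If V and A are independent given Y, then comparing the probabilities of
   small boxes around points (a_i, w_j, y), with a_0, a_1 in the support of A,
   yields F(a_0, w_0, y) + F(a_1, w_1, y) = F(a_0, w_1, y) + F(a_1, w_0, y).
   Differentiating in w,
     f2'(x) - f2'(x - sh) = c (f3'(z) - f3'(z + (cs - k)h)),  h = a_1 - a_0,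
   for all x and z.  Since A has no atoms its support has no isolated point, so
   h can be taken arbitrarily small and s f2''(x) = - c (cs - k) f3''(z).
   If s and cs - k are nonzero, both log-densities are quadratic and E_X, E are
   both Gaussian.  Otherwise (s and cs - k cannot both vanish, as k <> 0) one of
   f2, f3 is affine, which is impossible for a probability density. *)

(** * Translation invariance of Lebesgue measure *)

Section lebesgue_shift.
Context {R : realType} (r : R).

Let sh (z : measurableTypeR R) : measurableTypeR R := z + r.
Let msh : measurable_fun setT sh.
Proof. by apply: measurable_funD. Qed.
HB.instance Definition _ := isMeasurableFun.Build _ _ _ _ _ msh.

(** The image of Lebesgue measure under a translation agrees with it on half-open intervals, which
    determine it. *)
Lemma lebesgue_measure_shift (C : set R) : measurable C ->
  lebesgue_measure [set z | C (z + r)] = lebesgue_measure C.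
Proof.
move=> mC; apply/esym.
rewrite [LHS](@lebesgue_measure_unique _ (pushforward lebesgue_measure sh))//.
move=> _ [[x y] _ <-] /=.
rewrite /pushforward.
have -> : sh @^-1` `]x, y] = `](x - r), (y - r)]%classic.
  by apply/seteqP; split=> z; rewrite /sh /= !in_itv /= ltrBlDr lerBrDr.
by rewrite !lebesgue_measure_itv/= !lte_fin ltrD2r -!EFinB opprB addrA subrK.
Qed.
End lebesgue_shift.

(** * Independence of pairs of variables *)

Section independence.
Context {d : measure_display} {T : measurableType d} {R : realType}.
Variable P : probability T R.

(** For a fixed event [D], both sides are finite measures in [S]. They agree on rectangles, which
    form a pi-system generating the product sigma-algebra. *)
Lemma independent_pair (d1 d2 : measure_display) (T1 : measurableType d1)
    (T2 : measurableType d2) (X1 : T -> T1) (X2 : T -> T2) (D : set T) :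
  measurable_fun setT X1 -> measurable_fun setT X2 -> measurable D ->
  (forall B1 B2, measurable B1 -> measurable B2 ->
    P (X1 @^-1` B1 `&` X2 @^-1` B2 `&` D) =
    (P (X1 @^-1` B1 `&` X2 @^-1` B2) * P D)%E) ->
  forall S : set (T1 * T2), measurable S ->
    P ([set t | S (X1 t, X2 t)] `&` D) =
    (P [set t | S (X1 t, X2 t)] * P D)%E.
Proof.
move=> mX1 mX2 mD H S mS.
pose X t := (X1 t, X2 t).
have mX : measurable_fun setT X by exact: measurable_fun_pair.
have fD : P D \is a fin_num by exact: fin_num_measure.
have D0 : 0 <= fine (P D) by rewrite fine_ge0.
pose m1 : {measure set (T1 * T2) -> \bar R} := pushforward (mrestr P mD) X.
pose m2 : {measure set (T1 * T2) -> \bar R} :=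
  mscale (NngNum D0) (pushforward P X).
have m1E B : m1 mX B = P (X @^-1` B `&` D) by [].
have m2E B : m2 mX B = (P (X @^-1` B) * P D)%E.
  by rewrite -(fineK fD) muleC.
have m12 : m1 mX S = m2 mX S.
  apply: (measure_unique
    [set C | exists2 B1, measurable B1 & exists2 B2, measurable B2 & B1 `*` B2 = C]
    (fun=> setT)) => //.
  - by rewrite measurable_prod_measurableType.
  - move=> _ _ [B1 mB1 [B2 mB2 <-]] [C1 mC1 [C2 mC2 <-]].
    exists (B1 `&` C1); first exact: measurableI.
    by exists (B2 `&` C2); [exact: measurableI|rewrite setXI].
  - by move=> _; exists setT => //; exists setT => //; rewrite setXTT.
  - by rewrite bigcup_const.
  - move=> _ [B1 mB1 [B2 mB2 <-]].
    by rewrite m1E m2E; exact: H.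
  - move=> _; rewrite m1E preimage_setT setTI.
    by rewrite -ge0_fin_numE.
by move: m12; rewrite m1E m2E.
Qed.

(** Rectangles are replaced by general sets one pair at a time: [independent_pair] is applied to
    [(EH, EY)] with the event of [(A, EX)] fixed, then to [(A, EX)] with a rectangle event of
    [(EH, EY)] fixed. *)
Lemma mutually_independent4_pair (A EX EH EY : T -> R) :
  measurable_fun setT A -> measurable_fun setT EX ->
  measurable_fun setT EH -> measurable_fun setT EY ->
  mutually_independent4 P A EX EH EY ->
  forall S S' : set (R * R), measurable S -> measurable S' ->
    P ([set t | S (A t, EX t)] `&` [set t | S' (EH t, EY t)]) =
    (P [set t | S (A t, EX t)] * P [set t | S' (EH t, EY t)])%E.
Proof.
move=> mA mX mH mY ind S S' mS mS'.
have mpre (f : T -> R) B : measurable_fun setT f -> measurable B ->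
    measurable (f @^-1` B) by move=> mf mB; rewrite -[X in measurable X]setTI; exact: mf.
have mpair (f g : T -> R) (B : set (R * R)) : measurable_fun setT f ->
    measurable_fun setT g -> measurable B -> measurable [set t | B (f t, g t)].
  move=> mf mg mB; rewrite -[X in measurable X]setTI.
  exact: (measurable_fun_pair mf mg).
have ind12 B1 B2 : measurable B1 -> measurable B2 ->
    P (A @^-1` B1 `&` EX @^-1` B2) = (P (A @^-1` B1) * P (EX @^-1` B2))%E.
  move=> m1 m2; have := ind B1 B2 setT setT m1 m2 measurableT measurableT.
  by rewrite !preimage_setT !setIT probability_setT !mule1.
have ind34 B1 B2 : measurable B1 -> measurable B2 ->
    P (EH @^-1` B1 `&` EY @^-1` B2) = (P (EH @^-1` B1) * P (EY @^-1` B2))%E.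
  move=> m1 m2; have := ind setT setT B1 B2 measurableT measurableT m1 m2.
  by rewrite !preimage_setT !setTI probability_setT !mul1e.
rewrite setIC muleC; apply: (independent_pair _ _ _ _ EH EY) => //.
  exact: mpair.
move=> B3 B4 m3 m4; rewrite setIC muleC.
apply: independent_pair => //; first by apply: measurableI; exact: mpre.
move=> B1 B2 m1 m2.
by rewrite ind12// ind34// setIA ind// muleA.
Qed.

(** * Bounds for the joint law of W and Z + phi(W) when Z has a density and is independent of W *)

Section density_shift.
Context {d' : measure_display} {T' : measurableType d'}.
Variables (W : {mfun T >-> T'}) (Z : {mfun T >-> R}) (p : R -> R).
Hypothesis WZ : forall B B', measurable B -> measurable B' ->
  P (W @^-1` B `&` Z @^-1` B') = (P (W @^-1` B) * P (Z @^-1` B'))%E.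
Hypothesis pZ : has_density P Z p.
Variables (phi : T' -> R) (S : set T') (C : set R).
Hypotheses (mphi : measurable_fun setT phi) (mS : measurable S)
  (mC : measurable C).

Let V : set (T' * R) := [set wz | S wz.1 /\ C (wz.2 + phi wz.1)].

Let mV : measurable V.
Proof.
apply: measurableI.
  by rewrite -[X in measurable X]setTI; apply: measurable_fst.
rewrite -[X in measurable X]setTI.
have mg : measurable_fun setT (fun wz : T' * R => wz.2 + phi wz.1).
  apply: measurable_funD => //.
  exact: measurableT_comp.
exact: mg.
Qed.

(** By independence the law of [(W, Z)] is the product of the marginal laws, and its value on [V] is
    the integral of the measures of the sections. *)
Let jointE : P (W @^-1` S `&` [set t | C (Z t + phi (W t))]) =
  (\int[distribution P W]_w distribution P Z (xsection V w))%E.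
Proof.
have mWZ : measurable_fun setT (fun t => (W t, Z t)) by exact: measurable_fun_pair.
pose WZm : {mfun T >-> (T' * R)%type} := mfun_Sub (mem_set mWZ).
have := @product_measure_unique _ _ _ _ _ (distribution P W) (distribution P Z)
  (distribution P WZm).
by move=> /(_ WZ V mV) /esym.
Qed.

Let xsectionVE w : xsection V w = if w \in S then [set z | C (z + phi w)] else set0.
Proof.
apply/seteqP; split => z; rewrite /xsection/= inE.
  by move=> [/= Sw Cz]; rewrite mem_set.
by case: ifPn => // /set_mem.
Qed.

Let mCphi w : measurable [set z | C (z + phi w)].
Proof.
rewrite -[X in measurable X]setTI.
have mg : measurable_fun setT (fun z : R => z + phi w) by exact: measurable_funD.
exact: mg.
Qed.

Let m2 : measurable_fun setT (fun w => distribution P Z (xsection V w)).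
Proof. exact: measurable_fun_xsection. Qed.

Let intC (r : \bar R) : (0 <= r)%E ->
  (\int[distribution P W]_w ((\1_S w)%:E * r))%E = (P (W @^-1` S) * r)%E.
Proof.
move=> r0; rewrite ge0_integralZr ?integral_indic ?setIT//.
by apply: measurableT_comp.
Qed.

(** Given [W = w], the event says that [Z] lies in the translate of [C] by [- phi w]. There the
    density is at most [u], and the translate has the same Lebesgue measure as [C]. The lower bound
    [density_shift_ge] is symmetric. *)
Lemma density_shift_le (u : R) : 0 <= u ->
  (forall w y, S w -> C y -> p (y - phi w) <= u) ->
  (P (W @^-1` S `&` [set t | C (Z t + phi (W t))%R]) <=
   P (W @^-1` S) * (u%:E * lebesgue_measure C))%E.
Proof.
move=> u0 pu; have [mp [p0 Pp]] := pZ.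
have uC0 : (0 <= u%:E * lebesgue_measure C)%E by rewrite mule_ge0.
rewrite jointE -intC//; apply: ge0_le_integral => //.
- by apply: emeasurable_funM => //; exact: measurableT_comp.
- move=> w _; rewrite xsectionVE indicE; case: ifPn => [/set_mem Sw|_];
    last by rewrite measure0 mul0e.
rewrite mul1e [leLHS]Pp// -(lebesgue_measure_shift (phi w))//.
rewrite -integral_cst; last exact: mCphi.
apply: ge0_le_integral; try exact: mCphi.
- by move=> z _; rewrite lee_fin.
- by apply/measurable_EFinP; exact: measurable_funTS.
- by [].
- by move=> z /= Cz; rewrite lee_fin -[z](addrK (phi w)) pu.
Qed.

Lemma density_shift_ge (l : R) : 0 <= l ->
  (forall w y, S w -> C y -> l <= p (y - phi w)) ->
  (P (W @^-1` S) * (l%:E * lebesgue_measure C) <=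
   P (W @^-1` S `&` [set t | C (Z t + phi (W t))%R]))%E.
Proof.
move=> l0 pl; have [mp [p0 Pp]] := pZ.
have lC0 : (0 <= l%:E * lebesgue_measure C)%E by rewrite mule_ge0.
rewrite jointE -intC//; apply: ge0_le_integral => //.
- by move=> w _; rewrite mule_ge0// lee_fin.
- by apply: emeasurable_funM => //; exact: measurableT_comp.
- move=> w _; rewrite xsectionVE indicE; case: ifPn => [/set_mem Sw|_];
    last by rewrite measure0 mul0e.
rewrite mul1e [leRHS]Pp// -(lebesgue_measure_shift (phi w))//.
rewrite -integral_cst; last exact: mCphi.
apply: ge0_le_integral; try exact: mCphi.
- by [].
- by [].
- by apply/measurable_EFinP; exact: measurable_funTS.
- by move=> z /= Cz; rewrite lee_fin -[z](addrK (phi w)) pl.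
Qed.

End density_shift.
End independence.

(** * Comparison of conditional probabilities given W *)

Section conditional_probability.
Context {d : measure_display} {T : measurableType d} {R : realType}.
Variable P : probability T R.
Variable W : T -> R.
Hypothesis mW : measurable_fun setT W.

Let mpre (C : set R) : measurable C -> measurable (W @^-1` C).
Proof. by move=> mC; rewrite -[X in measurable X]setTI; exact: mW. Qed.

Let mcomp (g : R -> R) D : measurable_fun setT g ->
  measurable_fun D (fun t => (g (W t))%:E).
Proof.
move=> mg; apply: measurable_funTS; apply/measurable_EFinP.
exact: measurableT_comp.
Qed.

(** The integral over the whole space equals [P S], which is finite. *)
Lemma is_cond_prob_integrable (S : set T) (g : R -> R) : measurable S ->
  is_cond_prob P S W g -> P.-integrable setT (fun t => (g (W t))%:E).
Proof.
move=> mS [mg gE]; apply/integrableP; split; first exact: mcomp.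
apply/abse_integralP => //; first exact: mcomp.
have := gE setT measurableT; rewrite preimage_setT => <-.
rewrite setIT gee0_abs//; apply: le_lt_trans (probability_le1 P mS) _.
exact: ltry.
Qed.

(* On {r1 * g1 < r2 * g2} the integral of the positive function
   r2 * g2 - r1 * g1 is nonpositive. *)
Lemma is_cond_prob_le (S1 S2 : set T) (g1 g2 : R -> R) (r1 r2 : R) (L : set R) :
  measurable S1 -> measurable S2 -> measurable L ->
  is_cond_prob P S1 W g1 -> is_cond_prob P S2 W g2 ->
  (forall C, measurable C -> C `<=` L ->
    (r2%:E * P (S2 `&` W @^-1` C) <= r1%:E * P (S1 `&` W @^-1` C))%E) ->
  {ae P, forall t, L (W t) -> r2 * g2 (W t) <= r1 * g1 (W t)}.
Proof.
move=> mS1 mS2 mL cp1 cp2 H.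
have i1 := is_cond_prob_integrable _ _ mS1 cp1.
have i2 := is_cond_prob_integrable _ _ mS2 cp2.
have [mg1 g1E] := cp1; have [mg2 g2E] := cp2.
pose h w := r2 * g2 w - r1 * g1 w.
have mh : measurable_fun setT h.
  by apply: measurable_funB; apply: measurable_funM.
pose C := L `&` [set w | 0 < h w].
have mC : measurable C.
  apply: measurableI => //.
  have -> : [set w | 0 < h w] = h @^-1` `]0, +oo[.
    by apply/seteqP; split=> w /=; rewrite in_itv /= andbT.
  by rewrite -[X in measurable X]setTI; exact: mh.
have ih : P.-integrable setT (fun t => (h (W t))%:E).
  rewrite (_ : (fun t => _) =
    (fun t => r2%:E * (g2 (W t))%:E) \- (fun t => r1%:E * (g1 (W t))%:E))%E//.
  by apply: integrableB => //; apply: integrableZl.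
have ihC : (\int[P]_(t in W @^-1` C) (h (W t))%:E <= 0)%E.
  have sC f : P.-integrable setT f -> P.-integrable (W @^-1` C) f.
    by apply: integrableS => //; exact: mpre.
  rewrite (_ : (fun t => _) =
    (fun t => r2%:E * (g2 (W t))%:E) \- (fun t => r1%:E * (g1 (W t))%:E))%E//.
  rewrite integralB//; [|exact: mpre|exact/sC/integrableZl|exact/sC/integrableZl].
  rewrite integralZl//; [|exact: mpre|exact: sC].
  rewrite integralZl//; [|exact: mpre|exact: sC].
  rewrite -g1E// -g2E// sube_le0; apply: H => //.
  by apply: subIsetl.
have C0 : P (W @^-1` C) = 0%E.
  have /ae_eq_integral_abs : (\int[P]_(t in W @^-1` C) `|(h (W t))%:E| = 0)%E.
    apply/eqP; rewrite eq_le integral_ge0// andbT.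
    apply: le_trans ihC; rewrite le_eqVlt; apply/orP; left; apply/eqP.
    by apply: eq_integral => t /set_mem [_ /= /ltW h0]; rewrite ger0_norm.
  move=> /(_ (mpre _ mC) (mcomp _ _ mh)) /=.
  move=> [N [mN N0 sN]].
  apply/eqP; rewrite -measure_le0 -N0; apply: le_measure => //.
  - by rewrite inE; exact: mpre.
  - by rewrite inE.
  move=> t Ct; apply: sN => /(_ Ct)/= [] h0.
  by case: Ct => _ /=; rewrite h0 ltxx.
exists (W @^-1` C); split => //; first exact: mpre.
move=> t /= /not_implyP [Lt /negP]; rewrite -ltNge => lt.
by split => //=; rewrite subr_gt0.
Qed.

Lemma is_cond_prob_ge0 (S : set T) (g : R -> R) : measurable S ->
  is_cond_prob P S W g -> {ae P, forall t, 0 <= g (W t)}.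
Proof.
move=> mS cp; have := is_cond_prob_le _ _ _ _ 1 0 _ mS mS measurableT cp cp.
move=> H; apply: filterS (H _) => [t /(_ I)|C mC _].
  by rewrite mul0r mul1r.
by rewrite mul0e mul1e.
Qed.

Lemma is_cond_prob_unique (S : set T) (g1 g2 : R -> R) : measurable S ->
  is_cond_prob P S W g1 -> is_cond_prob P S W g2 ->
  {ae P, forall t, g1 (W t) = g2 (W t)}.
Proof.
move=> mS cp1 cp2.
have H1 := is_cond_prob_le _ _ _ _ 1 1 _ mS mS measurableT cp1 cp2 (fun _ _ _ => lexx _).
have H2 := is_cond_prob_le _ _ _ _ 1 1 _ mS mS measurableT cp2 cp1 (fun _ _ _ => lexx _).
apply: filterS2 H1 H2 => t /(_ I) + /(_ I); rewrite !mul1r => le1 le2.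
by apply/eqP; rewrite eq_le le1 le2.
Qed.

(* Writing phi_ij = g_j h_i for the conditional probability of
   {U in J_j, V in I_i}, the product phi_00 phi_11 equals phi_01 phi_10, while
   the bounds compare the phi_ij with each other almost surely on {W in L}. *)
Lemma cond_indep_cross (U V : T -> R) (I0 I1 J0 J1 L : set R)
    (mu : set R -> \bar R) (l00 l11 u00 u01 u10 : R) :
  measurable_fun setT U -> measurable_fun setT V ->
  measurable I0 -> measurable I1 -> measurable J0 -> measurable J1 ->
  measurable L ->
  cond_indep P U V W ->
  0 < l00 -> 0 < l11 -> 0 < u00 -> 0 < u01 -> 0 < u10 -> (0 < mu L)%E ->
  (forall C, measurable C -> C `<=` L ->
    [/\ (l00%:E * mu C <= P (U @^-1` J0 `&` V @^-1` I0 `&` W @^-1` C))%E,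
        (P (U @^-1` J0 `&` V @^-1` I0 `&` W @^-1` C) <= u00%:E * mu C)%E,
        (l11%:E * mu C <= P (U @^-1` J1 `&` V @^-1` I1 `&` W @^-1` C))%E,
        (P (U @^-1` J1 `&` V @^-1` I0 `&` W @^-1` C) <= u01%:E * mu C)%E &
        (P (U @^-1` J0 `&` V @^-1` I1 `&` W @^-1` C) <= u10%:E * mu C)%E]) ->
  l00 * l11 <= u01 * u10.
Proof.
move=> mU mV mI0 mI1 mJ0 mJ1 mL ci l00_gt0 l11_gt0 u00_gt0 u01_gt0 u10_gt0 muL H.
rewrite leNgt; apply/negP => lt.
have mUJ J : measurable J -> measurable (U @^-1` J).
  by move=> mJ; rewrite -[X in measurable X]setTI; exact: mU.
have mVI J : measurable J -> measurable (V @^-1` J).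
  by move=> mJ; rewrite -[X in measurable X]setTI; exact: mV.
have [g00 [h00 [cg00 [ch00 c00]]]] := ci J0 I0 mJ0 mI0.
have [g01 [h01 [cg01 [ch01 c01]]]] := ci J1 I0 mJ1 mI0.
have [g10 [h10 [cg10 [ch10 c10]]]] := ci J0 I1 mJ0 mI1.
have [g11 [h11 [cg11 [ch11 c11]]]] := ci J1 I1 mJ1 mI1.
have m00 : measurable (U @^-1` J0 `&` V @^-1` I0) by apply: measurableI; auto.
have m01 : measurable (U @^-1` J1 `&` V @^-1` I0) by apply: measurableI; auto.
have m10 : measurable (U @^-1` J0 `&` V @^-1` I1) by apply: measurableI; auto.
have m11 : measurable (U @^-1` J1 `&` V @^-1` I1) by apply: measurableI; auto.
(* The reference measure [mu] mediates: l P(S2, W in C) <= l u mu(C) <= u P(S1, W in C). *)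
have comp (l u : R) (S1 S2 : set T) g1 g2 : 0 < l -> 0 < u ->
    measurable S1 -> measurable S2 ->
    is_cond_prob P S1 W g1 -> is_cond_prob P S2 W g2 ->
    (forall C, measurable C -> C `<=` L ->
      (l%:E * mu C <= P (S1 `&` W @^-1` C))%E /\
      (P (S2 `&` W @^-1` C) <= u%:E * mu C)%E) ->
    {ae P, forall t, L (W t) -> l * g2 (W t) <= u * g1 (W t)}.
  move=> l0 u0 mS1 mS2 cp1 cp2 HC; apply: is_cond_prob_le cp1 cp2 _ => //.
  move=> C mC CL; have [le1 le2] := HC C mC CL.
  apply: (@le_trans _ _ (l%:E * (u%:E * mu C))%E).
    by rewrite lee_pmul2l ?lte_fin.
  by rewrite muleCA lee_pmul2l ?lte_fin.
have e1 : {ae P, forall t, L (W t) ->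
    l00 * (g01 (W t) * h01 (W t)) <= u01 * (g00 (W t) * h00 (W t))}.
  by apply: (comp l00 u01) c00 c01 _ => // C mC CL; have [? ? ? ? ?] := H C mC CL.
have e2 : {ae P, forall t, L (W t) ->
    l11 * (g10 (W t) * h10 (W t)) <= u10 * (g11 (W t) * h11 (W t))}.
  by apply: (comp l11 u10) c11 c10 _ => // C mC CL; have [? ? ? ? ?] := H C mC CL.
have e3 : {ae P, forall t, L (W t) ->
    l11 * (g00 (W t) * h00 (W t)) <= u00 * (g11 (W t) * h11 (W t))}.
  by apply: (comp l11 u00) c11 c00 _ => // C mC CL; have [? ? ? ? ?] := H C mC CL.
have p0 := is_cond_prob_ge0 _ _ m00 c00.
have p1 := is_cond_prob_ge0 _ _ m01 c01.
have p2 := is_cond_prob_ge0 _ _ m10 c10.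
have p3 := is_cond_prob_ge0 _ _ m11 c11.
(* [cond_indep] supplies new versions for every pair of sets; those of the same event are identified
   almost surely. *)
have q1 := is_cond_prob_unique _ _ _ (mUJ _ mJ0) cg00 cg10.
have q2 := is_cond_prob_unique _ _ _ (mUJ _ mJ1) cg01 cg11.
have q3 := is_cond_prob_unique _ _ _ (mVI _ mI0) ch00 ch01.
have q4 := is_cond_prob_unique _ _ _ (mVI _ mI1) ch10 ch11.
(* Multiplying [E1] and [E2] gives l00 l11 (phi_00 phi_11) <= u01 u10 (phi_00 phi_11), so the
   assumed strict inequality forces phi_00 phi_11 = 0. By [E3], phi_11 = 0 would imply phi_00 = 0,
   so phi_00 vanishes in any case. *)
have phi0 : {ae P, forall t, L (W t) -> g00 (W t) * h00 (W t) = 0}.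
  near=> t => Lt.
  have E1 : l00 * (g01 (W t) * h01 (W t)) <= u01 * (g00 (W t) * h00 (W t)).
    by move: Lt; near: t.
  have E2 : l11 * (g10 (W t) * h10 (W t)) <= u10 * (g11 (W t) * h11 (W t)).
    by move: Lt; near: t.
  have E3 : l11 * (g00 (W t) * h00 (W t)) <= u00 * (g11 (W t) * h11 (W t)).
    by move: Lt; near: t.
  have P0 : 0 <= g00 (W t) * h00 (W t) by near: t.
  have P1 : 0 <= g01 (W t) * h01 (W t) by near: t.
  have P2 : 0 <= g10 (W t) * h10 (W t) by near: t.
  have P3 : 0 <= g11 (W t) * h11 (W t) by near: t.
  have Q1 : g00 (W t) = g10 (W t) by near: t.
  have Q2 : g01 (W t) = g11 (W t) by near: t.
  have Q3 : h00 (W t) = h01 (W t) by near: t.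
  have Q4 : h10 (W t) = h11 (W t) by near: t.
  have cross : (g01 (W t) * h01 (W t)) * (g10 (W t) * h10 (W t)) =
      (g00 (W t) * h00 (W t)) * (g11 (W t) * h11 (W t)).
    by rewrite Q1 Q2 Q3 Q4; ring.
  move: cross E1 E2 E3 P0 P1 P2 P3.
  move: (g00 (W t) * _) (g01 (W t) * _) (g10 (W t) * _) (g11 (W t) * _).
  move=> a b c e ae bE cE eE a0 b0 c0 e0.
  have : (l00 * b) * (l11 * c) <= (u01 * a) * (u10 * e).
    by apply: ler_pM => //; rewrite mulr_ge0// ltW.
  rewrite mulrACA ae [leRHS]mulrACA => le.
  have ae0 : a * e = 0.
    apply/eqP; rewrite eq_le mulr_ge0// andbT leNgt; apply/negP => ae_gt0.
    by move: le; rewrite ler_pM2r// leNgt lt.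
  apply/eqP; rewrite eq_le a0 andbT leNgt; apply/negP => a_gt0.
  move/eqP: ae0; rewrite mulf_eq0 gt_eqF//= => /eqP ez.
  by move: eE; rewrite ez mulr0 leNgt mulr_gt0.
(* The integral of phi_00 over {W in L} is thus 0, yet it is at least l00 mu(L) > 0. *)
have [lo _ _ _ _] := H L mL (@subset_refl _ L).
have [_ /(_ L mL) c00E] := c00.
have int0 : (\int[P]_(t in W @^-1` L) (g00 (W t) * h00 (W t))%:E = 0)%E.
  rewrite -(integral0 P (W @^-1` L)); apply: ae_eq_integral => //.
  - exact: mpre.
  - exact: (mcomp _ _ (proj1 c00)).
  - by apply: filterS phi0 => t /[apply] ->.
by move: lo; rewrite c00E int0 leNgt mule_gt0.
Unshelve. all: by end_near. Qed.
End conditional_probability.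

(** * Derivatives and the functional equation *)

Section calculus.
Context {R : realType}.
Implicit Types f g u v : R -> R.

Lemma is_derive_derive1 f (x : R) : derivable f x 1 ->
  is_derive x 1 f (derive1 f x).
Proof. by move=> df; rewrite derive1E; exact: derivableP. Qed.

Lemma is_derive_affine (a r x : R) : is_derive x 1 (fun w => r + a * w) a.
Proof.
have -> : (fun w => r + a * w) = cst r + a *: (id : R -> R).
  by apply/funext.
by apply: is_derive_eq; rewrite add0r /GRing.scale/= mulr1.
Qed.

Lemma is_derive_comp_affine f (l a r x : R) :
  is_derive (r + a * x) 1 f l ->
  is_derive x 1 (fun w => f (r + a * w)) (l * a).
Proof.
move=> df.
exact: (@is_derive1_comp _ f (fun w => r + a * w) _ _ _ df (is_derive_affine a r x)).
Qed.

(** The difference quotients at 0 converge to [D] and vanish at nonzero points arbitrarily close to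
    0. *)
Lemma is_derive_accumulating_zeros f (D : R) : is_derive (0 : R) (1 : R) f D -> f 0 = 0 ->
  (forall e, 0 < e -> exists h, [/\ h != 0, `|h| < e & f h = 0]) -> D = 0.
Proof.
move=> dfD f0 zeros; apply/eqP; apply/negP => /negP D0.
have : (fun h => h^-1 *: ((f \o shift 0) (h *: (1 : R)) - f 0)) @ 0^' --> D.
  by rewrite -(derive_val (is_derive := dfD)); exact: ex_derive.
move=> /cvgrPdist_lt/(_ `|D|); rewrite normr_gt0 => /(_ D0) [e /= e0 He].
have [h [h0 he fh0]] := zeros e e0.
have := He h; rewrite /ball/= sub0r normrN => /(_ he h0).
by rewrite [h *: 1]mulr1 addr0 fh0 f0 subrr scaler0 subr0 ltxx.
Qed.

(** Integration is done twice by subtracting the expected primitive: the difference has zero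
    derivative and is therefore constant. *)
Lemma second_derivative_cst f (kappa : R) :
  (forall x, derivable f x 1) -> (forall x, derivable (derive1 f) x 1) ->
  (forall x, derive1 (derive1 f) x = kappa) ->
  forall x, f x = kappa / 2 * x ^+ 2 + derive1 f 0 * x + f 0.
Proof.
move=> df ddf fk.
have f'E x : derive1 f x = kappa * x + derive1 f 0.
  have H (y : R) : is_derive y 1 (fun y => derive1 f y - (0 + kappa * y)) 0.
    apply: is_derive_eq; last exact: subrr kappa.
    apply: is_deriveB; last exact: is_derive_affine.
    by rewrite -(fk y); exact: is_derive_derive1.
  have := is_derive_0_is_cst x 0 H.
  by rewrite /= mulr0 addr0 subr0 add0r => <-; rewrite addrC subrK.
have H (y : R) : is_derive y 1
    (fun y => f y - ((derive1 f 0 + kappa / 2 * y) * (0 + 1 * y))) 0.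
  apply: is_derive_eq.
    by apply: is_deriveB; exact: is_derive_derive1.
  by rewrite f'E /GRing.scale/=; field.
move=> x; have /= := is_derive_0_is_cst x 0 H.
by rewrite !mulr0 !addr0 mulr0 subr0 => <-; ring.
Qed.

(** For fixed [x] and [z], the difference of the two sides of the equation is a function [phi] of
    the increment [h] whose zeros accumulate at 0, so its derivative at 0 vanishes. It is used with
    [u] and [v] the first derivatives of the log-densities. *)
Lemma second_derivatives_proportional u v (s c m : R) :
  (forall x, derivable u x 1) -> (forall x, derivable v x 1) ->
  (forall e, 0 < e -> exists h, [/\ h != 0, `|h| < e &
    forall x z, u x - u (x - s * h) = c * (v z - v (z + m * h))]) ->
  forall x z, s * derive1 u x = - (c * m) * derive1 v z.
Proof.
move=> du dv zeros x z.
pose phi (h : R) := - c * (v z - v (z + m * h)) + (u x - u (x + - s * h)).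
have dphi : is_derive (0 : R) (1 : R) phi (c * m * derive1 v z + s * derive1 u x).
  have dU : is_derive (0 : R) (1 : R) (fun h => u (x + - s * h)) (derive1 u x * - s).
    by apply: is_derive_comp_affine; rewrite mulr0 addr0; exact: is_derive_derive1.
  have dV : is_derive (0 : R) (1 : R) (fun h => v (z + m * h)) (derive1 v z * m).
    by apply: is_derive_comp_affine; rewrite mulr0 addr0; exact: is_derive_derive1.
  have -> : phi = - c *: (cst (v z) - (fun h => v (z + m * h)))
      + (cst (u x) - (fun h => u (x + - s * h))) by apply/funext.
  by apply: is_derive_eq; rewrite /GRing.scale/=; ring.
have := is_derive_accumulating_zeros _ _ dphi.
rewrite {1}/phi !mulr0 !addr0 !subrr mulr0 addr0 => /(_ erefl) H.
suff : c * m * derive1 v z + s * derive1 u x = 0.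
  by move=> /eqP; rewrite addrC addr_eq0 mulNr => /eqP.
apply: H => e e0; have [h [h0 he Hh]] := zeros e e0.
exists h; split => //; rewrite /phi [- s * h]mulNr (Hh x z); ring.
Qed.

End calculus.

(** * Densities with quadratic logarithm are Gaussian *)

Section gaussian.
Context {d : measure_display} {T : measurableType d} {R : realType}.
Variable P : probability T R.

Lemma gaussian_pdfE (m s : R) : 0 < s -> gaussian_pdf m s = normal_pdf m s.
Proof.
move=> s0; rewrite normal_pdfE ?gt_eqF//; apply/funext => x.
rewrite /gaussian_pdf /normal_peak /normal_fun.
have -> : s ^+ 2 * pi *+ 2 = s ^+ 2 * (2 * pi) by ring.
have -> : s ^+ 2 *+ 2 = 2 * s ^+ 2 by ring.
by rewrite [in RHS]sqrtrM ?sqr_ge0// sqrtr_sqr ger0_norm ?ltW.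
Qed.

Lemma has_density_lb (X : T -> R) (p : R -> R) (B : set R) (r : R) :
  measurable_fun setT X -> has_density P X p -> measurable B -> 0 <= r ->
  (forall x, B x -> r <= p x) -> (r%:E * lebesgue_measure B <= 1)%E.
Proof.
move=> mX [mp [p0 pE]] mB r0 rp.
have mXB : measurable (X @^-1` B) by rewrite -[X in measurable X]setTI; exact: mX.
apply: le_trans (probability_le1 P mXB); rewrite pE// -integral_cst//.
apply: ge0_le_integral => //.
by apply/measurable_EFinP; exact: measurable_funTS.
Qed.

(** If [kappa] were nonnegative, the density would be at least exp(r) on the half-line where l x >=
    0, which gives a total mass above 1. Otherwise completing the square yields a multiple of a
    Gaussian density. *)
Lemma log_quadratic_density_gaussian (X : T -> R) (p : R -> R) (kappa l r : R) :
  measurable_fun setT X -> has_density P X p ->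
  (forall x, p x = expR (kappa / 2 * x ^+ 2 + l * x + r)) ->
  kappa < 0 /\ is_gaussian P X.
Proof.
move=> mX pX pE.
have kappa0 : kappa < 0.
  rewrite ltNge; apply/negP => kappa0.
  (* An interval of this length carries mass at least exp(r) N = 1 + exp(r) > 1. *)
  pose N := expR (- r) + 1.
  have N0 : 0 < N by rewrite addr_gt0 ?expR_gt0.
  have rN : 1 < expR r * N.
    by rewrite mulrDr mulr1 -expRD subrr expR0 ltrDl expR_gt0.
  have lb x : 0 <= l * x -> expR r <= p x.
    move=> lx; rewrite pE ler_expR lerDr addr_ge0// mulr_ge0 ?sqr_ge0//.
    by rewrite divr_ge0.
  have [l0|l0] := leP 0 l.
    have : ((expR r)%:E * lebesgue_measure `[0%R, N]%classic <= 1)%E.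
      apply: (has_density_lb X p _ _ mX pX) => //.
      by move=> x /=; rewrite in_itv/= => /andP[x0 _]; apply: lb; rewrite mulr_ge0.
    by rewrite lebesgue_measure_itv/= lte_fin N0 sube0 -EFinM lee_fin leNgt rN.
  have : ((expR r)%:E * lebesgue_measure `[(- N)%R, 0%R]%classic <= 1)%E.
    apply: (has_density_lb X p _ _ mX pX) => //.
    move=> x /=; rewrite in_itv/= => /andP[_ x0]; apply: lb.
    by rewrite mulr_le0// ltW.
  rewrite lebesgue_measure_itv/= lte_fin oppr_lt0 N0 -EFinB sub0r opprK.
  by rewrite -EFinM lee_fin leNgt rN.
split => //.
have V0 : 0 < - kappa^-1 by rewrite oppr_gt0 invr_lt0.
(* Standard deviation and mean read off from the completed square. *)
pose s := Num.sqrt (- kappa^-1); pose m := - l / kappa.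
have s0 : 0 < s by rewrite sqrtr_gt0.
have s2 : s ^+ 2 = - kappa^-1 by rewrite sqr_sqrtr// ltW.
exists m, s; split => //.
have spi0 : s * Num.sqrt (2 * pi) != 0.
  by rewrite mulf_neq0 ?gt_eqF// sqrtr_gt0 mulr_gt0// pi_gt0.
pose K := s * Num.sqrt (2 * pi) * expR (r - l ^+ 2 / (2 * kappa)).
have pK x : p x = K * gaussian_pdf m s x.
  rewrite /gaussian_pdf /K mulrACA mulfV// mul1r.
  rewrite -expRD pE s2 /m; congr expR; field.
  by rewrite lt_eqF.
have mnorm : measurable_fun setT (gaussian_pdf m s).
  by rewrite gaussian_pdfE//; exact: measurable_normal_pdf.
have [mp [p0 PE]] := pX.
(* Both densities have integral 1. *)
have K1 : K = 1.
  have := PE setT measurableT; rewrite preimage_setT probability_setT.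
  under eq_integral do rewrite pK EFinM.
  rewrite ge0_integralZl//; last first.
  - by rewrite lee_fin mulr_ge0 ?expR_ge0// mulr_ge0 ?sqrtr_ge0// ltW.
  - by move=> x _; rewrite gaussian_pdfE// lee_fin normal_pdf_ge0.
  - exact/measurable_EFinP.
  by rewrite gaussian_pdfE// integral_normal_pdf mule1 => -[->].
suff -> : gaussian_pdf m s = p by [].
by apply/funext => x; rewrite pK K1 mul1r.
Qed.

(** The sign of [kappa] is recorded because it rules out an affine log-density, the case
    [kappa = 0]. *)
Lemma cst_log_second_derivative_gaussian (X : T -> R) (p : R -> R) (kappa : R) :
  measurable_fun setT X -> has_density P X p -> (forall x, 0 < p x) ->
  thrice_differentiable (fun x => ln (p x)) ->
  (forall x, derive1 (derive1 (fun x => ln (p x))) x = kappa) ->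
  kappa < 0 /\ is_gaussian P X.
Proof.
move=> mX pX p0 f3 fk.
have df x : derivable (fun x => ln (p x)) x 1 by exact: (f3 0%N).
have ddf x : derivable (derive1 (fun x => ln (p x))) x 1 by exact: (f3 1%N).
have quad x := second_derivative_cst _ _ df ddf fk x.
apply: (log_quadratic_density_gaussian _ _ _
  (derive1 (fun x => ln (p x)) 0) (ln (p 0)) mX pX) => x.
by have /= <- := quad x; rewrite lnK// posrE.
Qed.

End gaussian.

(** * The topological support of a law *)

Section support.
Context {d : measure_display} {T : measurableType d} {R : realType}.
Variable P : probability T R.
Variable X : T -> R.
Hypothesis mX : measurable_fun setT X.

Definition support_of : set R :=
  [set a | forall e, 0 < e -> (0 < P (X @^-1` ball a e))%E].

Let mpre (B : set R) : measurable B -> measurable (X @^-1` B).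
Proof. by move=> mB; rewrite -[X in measurable X]setTI; exact: mX. Qed.

Let mball (a e : R) : measurable (X @^-1` ball a e).
Proof. by apply: mpre; exact: measurable_ball. Qed.

(* The complement of the support is covered by countably many null balls with
   rational centers. *)
Lemma negligible_setC_support : P.-negligible (X @^-1` ~` support_of).
Proof.
pose B (qn : rat * nat) := X @^-1` ball (ratr qn.1 : R) (qn.2.+1%:R^-1).
pose F k := if unpickle k is Some qn then
  if P (B qn) == 0%E then B qn else set0 else set0.
apply: (@negligibleS _ _ _ P (\bigcup_k F k)); last first.
  apply: negligible_bigcup => k; rewrite /F.
  case: unpickle => [qn|]; last exact: negligible_set0.
  case: ifPn => [/eqP B0|_]; last exact: negligible_set0.
  by apply/negligibleP => //; exact: mball.
move=> t /= /existsNP[/= e /not_implyP[e0 /negP]]; rewrite -leNgt measure_le0 => /eqP Pe.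
(* A ball of radius 1/(n+1) < e/2 whose center is within 1/(n+1) of [X t] contains [X t] and lies in
   the null ball of radius [e] around [X t]. *)
have [n ne] : exists n, n.+1%:R^-1 < e / 2.
  by have [n] := ltr_add_invr (divr_gt0 e0 (ltr0Sn _ 1)); rewrite add0r; exists n.
have n0 : 0 < n.+1%:R^-1 :> R by rewrite invr_gt0.
have [q] : exists q : rat, ratr q \in `](X t - n.+1%:R^-1), (X t)[.
  by apply: rat_in_itvoo; rewrite ltrBlDr ltrDl.
rewrite in_itv/= => /andP[q1 q2].
have Bt (x : R) : ball (ratr q : R) n.+1%:R^-1 x -> ball (X t) (e : R) x.
  rewrite /ball/= !ltr_distlC => /andP[].
  move: (ratr q) (n.+1%:R^-1) (X t) q1 q2 ne n0 => b r a.
  by move=> *; apply/andP; split; lra.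
have [j jE] : exists j, unpickle j = Some (q, n).
  by exists (pickle (q, n)); exact: pickleK.
exists j => //; rewrite /F jE.
have -> : P (B (q, n)) == 0%E.
  rewrite -measure_le0 -Pe; apply: le_measure; rewrite ?inE; [exact: mball..|].
  by move=> u; exact: Bt.
rewrite /B /ball /= ltr_distlC.
move: (ratr q) (n.+1%:R^-1) (X t) q1 q2 n0 => b r a *.
by apply/andP; split; lra.
Qed.

Lemma support_neq0 : support_of !=set0.
Proof.
apply/set0P/eqP => s0; have := negligible_setC_support.
rewrite s0 setC0 preimage_setT => /(measure_negligible measurableT) P0.
by have /eqP := etrans (esym (probability_setT P)) P0; rewrite onee_eq0.
Qed.

(** The density makes {a} a null set. If [a] were the only support point in the ball, the ball would
    be covered by {a} and the complement of the support, and so would be null. *)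
Lemma support_no_isolated_point (p : R -> R) (a e : R) :
  has_density P X p -> support_of a -> 0 < e ->
  exists a', [/\ support_of a', a' != a & `|a' - a| < e].
Proof.
move=> [_ [_ pX]] sa e0; apply: contrapT => none.
have Xa : P.-negligible (X @^-1` [set a]).
  by apply/negligibleP; [exact: mpre|rewrite [LHS]pX// integral_set1].
have : P.-negligible (X @^-1` ball a e).
  apply: negligibleS (negligibleU negligible_setC_support Xa) => t /=.
  rewrite /ball/= distrC => te; have [->|ta] := eqVneq (X t) a; first by right.
  by left => st; apply: none; exists (X t).
move=> /(measure_negligible (mball _ _)) P0.
by have := sa e e0; rewrite P0 ltxx.
Qed.

End support.

(** * Log-densities in the linear model V = sA + EX, Y = kA + c EX + E *)

Section linear_model.
Context {d : measure_display} {T : measurableType d} {R : realType}.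
Variable P : probability T R.
Variables (A EX E : {mfun T >-> R}) (p2 p3 : R -> R) (s k c : R).
Hypothesis indA : forall B B', measurable B -> measurable B' ->
  P (A @^-1` B `&` EX @^-1` B') = (P (A @^-1` B) * P (EX @^-1` B'))%E.
Hypothesis indE : forall (S : set (R * R)) B', measurable S -> measurable B' ->
  P ([set t | S (A t, EX t)] `&` E @^-1` B') =
  (P [set t | S (A t, EX t)] * P (E @^-1` B'))%E.
Hypotheses (dens2 : has_density P EX p2) (dens3 : has_density P E p3).
Hypotheses (p2_gt0 : forall x, 0 < p2 x) (p3_gt0 : forall x, 0 < p3 x).
Hypotheses (cf2 : continuous (fun x => ln (p2 x)))
  (cf3 : continuous (fun x => ln (p3 x))).

Let V t := s * A t + EX t.
Let Y t := k * A t + c * EX t + E t.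

Let mV : measurable_fun setT V.
Proof. by apply: measurable_funD => //; exact: measurable_funM. Qed.

Let mY : measurable_fun setT Y.
Proof.
by apply: measurable_funD => //; apply: measurable_funD; exact: measurable_funM.
Qed.

(* Logarithm of the conditional density of (V, Y) given A = a. *)
Let F a w y := ln (p2 (w - s * a)) + ln (p3 (y - (k * a + c * (w - s * a)))).

Let log_continuous_bounds (p : R -> R) (x0 eta : R) : (forall x, 0 < p x) ->
  continuous (fun x => ln (p x)) -> 0 < eta ->
  exists2 r, 0 < r & forall x, `|x - x0| < r ->
    expR (ln (p x0) - eta) <= p x <= expR (ln (p x0) + eta).
Proof.
move=> p0 cf eta0.
have /cvgrPdist_lt/(_ _ eta0)[r /= r0 Hr] := cf x0.
exists r => // x xr; have := Hr x; rewrite /ball/= distrC => /(_ xr).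
rewrite -{2 3}[p x]lnK ?posrE// !ler_expR ltr_distlC => /andP[h1 h2].
by apply/andP; split; lra.
Qed.

(** On small boxes the joint law is nearly exp(F) times P(A in ball) times the length [r *+ 2] of
    the ball around [w] times Lebesgue measure in [Y]. Each of the two log-densities contributes an
    error [eta]. All measurable [C] in the ball are covered at once, as [cond_indep_cross]
    requires. *)
Lemma local_bounds (a w y eta : R) : 0 < eta ->
  \forall r \near 0^'+, forall C : set R, measurable C -> C `<=` ball y r ->
    ((expR (F a w y - 2 * eta) * (fine (P (A @^-1` ball a r)) * (r *+ 2)))%:E
      * lebesgue_measure C <=
      P (V @^-1` ball w r `&` A @^-1` ball a r `&` Y @^-1` C))%E /\
    (P (V @^-1` ball w r `&` A @^-1` ball a r `&` Y @^-1` C) <=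
     (expR (F a w y + 2 * eta) * (fine (P (A @^-1` ball a r)) * (r *+ 2)))%:E
      * lebesgue_measure C)%E.
Proof.
move=> eta0.
pose x0 := w - s * a; pose z0 := y - (k * a + c * x0).
have [r2 r2_gt0 H2] := log_continuous_bounds _ x0 _ p2_gt0 cf2 eta0.
have [r3 r3_gt0 H3] := log_continuous_bounds _ z0 _ p3_gt0 cf3 eta0.
(* Inside the boxes of radius [r], the arguments of [p2] and [p3] differ from [x0] and [z0] by at
   most [r] times these two constants. *)
have D2_gt0 : 0 < 1 + `|s| by rewrite ltr_pwDl.
have D3_gt0 : 0 < 1 + `|k| + `|c| * (1 + `|s|).
  by rewrite ltr_pwDl ?mulr_ge0 ?ltr_pwDl// ltW.
near=> r => C mC Cr.
have r0 : 0 < r by near: r; exact: nbhs_right_gt.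
have rr2 : r * (1 + `|s|) < r2.
  by rewrite -ltr_pdivlMr//; near: r; apply: nbhs_right_lt; rewrite divr_gt0.
have rr3 : r * (1 + `|k| + `|c| * (1 + `|s|)) < r3.
  by rewrite -ltr_pdivlMr//; near: r; apply: nbhs_right_lt; rewrite divr_gt0.
have mAr : measurable (ball a r : set R) by exact: measurable_ball.
have mwr : measurable (ball w r : set R) by exact: measurable_ball.
have near2 a' w' : ball a r a' -> ball w r w' -> `|w' - s * a' - x0| <= r * (1 + `|s|).
  rewrite /ball/= => ha hw.
  have -> : w' - s * a' - x0 = (w' - w) + s * (a - a') by rewrite /x0; ring.
  apply: (le_trans (ler_normD _ _)); rewrite normrM mulrDr mulr1 lerD//.
    by rewrite distrC ltW.
  by rewrite mulrC ler_wpM2r// ltW.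
have dens2_bounds a' w' : ball a r a' -> ball w r w' ->
    expR (ln (p2 x0) - eta) <= p2 (w' - s * a') <= expR (ln (p2 x0) + eta).
  by move=> ha hw; apply: H2; apply: le_lt_trans rr2; exact: near2.
have dens3_bounds a' x' y' : ball a r a' -> ball w r (s * a' + x') -> ball y r y' ->
    expR (ln (p3 z0) - eta) <= p3 (y' - (k * a' + c * x')) <= expR (ln (p3 z0) + eta).
  move=> ha hw hy; apply: H3; apply: le_lt_trans rr3.
  have := near2 _ _ ha hw; rewrite [s * a' + x']addrC addrK => hx.
  have -> : y' - (k * a' + c * x') - z0 = (y' - y) + k * (a - a') + c * (x0 - x').
    by rewrite /z0; ring.
  have -> : r * (1 + `|k| + `|c| * (1 + `|s|)) =
      r + `|k| * r + `|c| * (r * (1 + `|s|)) by ring.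
  apply: (le_trans (ler_normD _ _)); rewrite lerD//.
    apply: (le_trans (ler_normD _ _)); rewrite lerD//.
      by rewrite distrC ltW.
    by rewrite normrM ler_wpM2l// ltW.
  by rewrite normrM ler_wpM2l// distrC.
have PAfin : P (A @^-1` ball a r) \is a fin_num.
  by apply: fin_num_measure; rewrite -[X in measurable X]setTI; exact: measurable_funP.
have mAEX : measurable_fun setT (fun t => (A t, EX t)) by exact: measurable_fun_pair.
pose AX : {mfun T >-> (R * R)%type} := mfun_Sub (mem_set mAEX).
pose S : set (R * R) := [set ax | ball a r ax.1 /\ ball w r (s * ax.1 + ax.2)].
have mS : measurable S.
  apply: measurableI; first by rewrite -[X in measurable X]setTI; apply: measurable_fst.
  have mg : measurable_fun setT (fun ax : R * R => s * ax.1 + ax.2).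
    by apply: measurable_funD => //; apply: measurable_funM.
  by rewrite -[X in measurable X]setTI; exact: mg.
have mphi : measurable_fun setT (fun ax : R * R => k * ax.1 + c * ax.2).
  by apply: measurable_funD => //; apply: measurable_funM.
have ms : measurable_fun setT ( *%R s) by exact: measurable_funM.
have SE : AX @^-1` S = A @^-1` ball a r `&` [set t | ball w r (EX t + s * A t)].
  by apply/seteqP; split=> t; rewrite /S /= addrC.
have VYE : V @^-1` ball w r `&` A @^-1` ball a r `&` Y @^-1` C =
    AX @^-1` S `&` [set t | C (E t + (k * (AX t).1 + c * (AX t).2))].
  rewrite SE; apply/seteqP; split=> t /=; rewrite /V /Y [s * _ + _]addrC [E t + _]addrC;
    by move=> [[? ?] ?].
have lam_w : lebesgue_measure (ball w r) = (r *+ 2)%:E.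
  by rewrite lebesgue_measure_ball// ltW.
rewrite VYE; split.
(* First [E] is integrated out given [(A, EX)], which produces the factor of [p3]; then [EX] given
   [A], which produces that of [p2]. *)
- apply: le_trans (density_shift_ge P AX E p3 indE dens3
    (fun ax : R * R => k * ax.1 + c * ax.2) S C mphi mS mC _ (expR_ge0 (ln (p3 z0) - eta)) _);
    last first.
    move=> [a' x'] y' [/= ha hw] Cy.
    by have /andP[] := dens3_bounds _ _ _ ha hw (Cr _ Cy).
  have := density_shift_ge P A EX p2 indA dens2
    ( *%R s) (ball a r) (ball w r) ms mAr mwr _ (expR_ge0 (ln (p2 x0) - eta)).
  rewrite -SE lam_w => H.
  have {}H := H (fun a' w' ha hw => proj1 (andP (dens2_bounds a' w' ha hw))).
  apply: le_trans (lee_wpmul2r _ H); last by rewrite mule_ge0// lee_fin expR_ge0.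
  rewrite -(fineK PAfin) muleA -!EFinM lee_wpmul2r// lee_fin.
  rewrite le_eqVlt; apply/orP; left; apply/eqP.
  have -> : F a w y - 2 * eta = (ln (p2 x0) - eta) + (ln (p3 z0) - eta).
    by rewrite /F -/x0 -/z0; ring.
  by rewrite (expRD (ln (p2 x0) - eta)); ring.
- apply: le_trans.
    apply: (density_shift_le P AX E p3 indE dens3
      (fun ax : R * R => k * ax.1 + c * ax.2) S C mphi mS mC _ (expR_ge0 (ln (p3 z0) + eta)) _).
    move=> [a' x'] y' [/= ha hw] Cy.
    by have /andP[] := dens3_bounds _ _ _ ha hw (Cr _ Cy).
  have := density_shift_le P A EX p2 indA dens2
    ( *%R s) (ball a r) (ball w r) ms mAr mwr _ (expR_ge0 (ln (p2 x0) + eta)).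
  rewrite -SE lam_w => H.
  have {}H := H (fun a' w' ha hw => proj2 (andP (dens2_bounds a' w' ha hw))).
  apply: le_trans (lee_wpmul2r _ H) _; first by rewrite mule_ge0// lee_fin expR_ge0.
  rewrite -(fineK PAfin) muleA -!EFinM lee_wpmul2r// lee_fin.
  rewrite le_eqVlt; apply/orP; left; apply/eqP.
  have -> : F a w y + 2 * eta = (ln (p2 x0) + eta) + (ln (p3 z0) + eta).
    by rewrite /F -/x0 -/z0; ring.
  by rewrite (expRD (ln (p2 x0) + eta)); ring.
Unshelve. all: by end_near. Qed.

(** [cond_indep_cross] is applied to balls of a common small radius. The factors P(A in ball) and
    [r *+ 2] occur on both sides and cancel; they are positive because [a0] and [a1] lie in the
    support. *)
Lemma cond_indep_log_density_le (a0 a1 w0 w1 y : R) :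
  cond_indep P V A Y -> support_of P A a0 -> support_of P A a1 ->
  F a0 w0 y + F a1 w1 y <= F a0 w1 y + F a1 w0 y.
Proof.
move=> ci sa0 sa1; apply/ler_addgt0Pr => e e0.
(* Four bounds enter, each with error 2 (e/8), for a total of [e]. *)
have eta0 : 0 < e / 8 by rewrite divr_gt0.
have lb a w := local_bounds a w y _ eta0.
have [r [[[B00 B01] [B10 B11]] r0]] := filter_ex
  (filterI (filterI (filterI (lb a0 w0) (lb a0 w1))
                    (filterI (lb a1 w0) (lb a1 w1))) (nbhs_right_gt (0 : R))).
have q_gt0 a : support_of P A a -> 0 < fine (P (A @^-1` ball a r)) * (r *+ 2).
  move=> sa; rewrite mulr_gt0 ?mulrn_wgt0//; apply: fine_gt0.
  rewrite sa//=; apply: le_lt_trans (probability_le1 P _) (ltry _).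
  by rewrite -[X in measurable X]setTI; apply: measurable_funP => //; exact: measurable_ball.
have q0 := q_gt0 a0 sa0; have q1 := q_gt0 a1 sa1.
have mb (x : R) : measurable (ball x r : set R) by exact: measurable_ball.
have muL : (0 < lebesgue_measure (ball y r))%E.
  by rewrite lebesgue_measure_ball ?ltW// lte_fin mulrn_wgt0.
have := cond_indep_cross P Y mY V A (ball a0 r) (ball a1 r) (ball w0 r) (ball w1 r)
  (ball y r) lebesgue_measure _ _ _ _ _ mV (@measurable_funPT _ _ _ _ A)
  (mb _) (mb _) (mb _) (mb _) (mb _) ci
  (mulr_gt0 (expR_gt0 (F a0 w0 y - 2 * (e / 8))) q0)
  (mulr_gt0 (expR_gt0 (F a1 w1 y - 2 * (e / 8))) q1)
  (mulr_gt0 (expR_gt0 (F a0 w0 y + 2 * (e / 8))) q0)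
  (mulr_gt0 (expR_gt0 (F a0 w1 y + 2 * (e / 8))) q0)
  (mulr_gt0 (expR_gt0 (F a1 w0 y + 2 * (e / 8))) q1) muL.
have bnd : forall C, measurable C -> C `<=` ball y r -> _ := fun C mC CL =>
  And5 (B00 C mC CL).1 (B00 C mC CL).2 (B11 C mC CL).1
    (B01 C mC CL).2 (B10 C mC CL).2.
move=> /(_ bnd).
rewrite mulrACA [leRHS]mulrACA ler_pM2r; last exact: mulr_gt0.
by rewrite -!expRD ler_expR => *; lra.
Qed.

Lemma cond_indep_derivatives (a0 a1 : R) :
  (forall x, derivable (fun x => ln (p2 x)) x 1) ->
  (forall x, derivable (fun x => ln (p3 x)) x 1) ->
  cond_indep P V A Y -> support_of P A a0 -> support_of P A a1 ->
  let f2 := derive1 (fun x => ln (p2 x)) in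
  let f3 := derive1 (fun x => ln (p3 x)) in
  forall x z, f2 x - f2 (x - s * (a1 - a0)) =
    c * (f3 z - f3 (z + (c * s - k) * (a1 - a0))).
Proof.
move=> df2 df3 ci sa0 sa1 f2 f3 x z.
(* With these values the arguments of the two log-densities at [a0] are exactly [x] and [z]. *)
pose w0 := x + s * a0; pose y := z + k * a0 + c * x.
pose G w := F a0 w y - F a1 w y.
(* Exchanging the points [w] and 0 turns the inequality of [cond_indep_log_density_le] into its
   reverse. *)
have Gcst w : G w = G 0.
  apply/eqP; rewrite eq_le /G.
  have := cond_indep_log_density_le a0 a1 w 0 y ci sa0 sa1.
  have := cond_indep_log_density_le a0 a1 0 w y ci sa0 sa1.
  by move=> *; apply/andP; split; lra.
have d2 (a : R) : is_derive w0 1 (fun w => ln (p2 (- (s * a) + 1 * w))) (f2 (w0 - s * a) * 1).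
  apply: (is_derive_comp_affine (fun x => ln (p2 x))).
  by rewrite mul1r addrC; exact: is_derive_derive1.
have d3 (a : R) : is_derive w0 1
    (fun w => ln (p3 (y - k * a + c * s * a + - c * w)))
    (f3 (y - (k * a + c * (w0 - s * a))) * - c).
  apply: (is_derive_comp_affine (fun x => ln (p3 x))).
  have -> : y - k * a + c * s * a + - c * w0 = y - (k * a + c * (w0 - s * a)) by ring.
  exact: is_derive_derive1.
have GE : G = (fun w => ln (p2 (- (s * a0) + 1 * w))) +
    (fun w => ln (p3 (y - k * a0 + c * s * a0 + - c * w))) -
    ((fun w => ln (p2 (- (s * a1) + 1 * w))) +
    (fun w => ln (p3 (y - k * a1 + c * s * a1 + - c * w)))).
  apply/funext => w; rewrite /G /F; congr (ln (p2 _) + ln (p3 _) - (ln (p2 _) + ln (p3 _))); ring.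
have dG : is_derive w0 1 G (f2 (w0 - s * a0) * 1 + f3 (y - (k * a0 + c * (w0 - s * a0))) * - c
   - (f2 (w0 - s * a1) * 1 + f3 (y - (k * a1 + c * (w0 - s * a1))) * - c)).
  rewrite GE; exact: (is_deriveB (is_deriveD (d2 a0) (d3 a0)) (is_deriveD (d2 a1) (d3 a1))).
have G0 : is_derive w0 1 G 0.
  have -> : G = cst (G 0) by apply/funext => w; rewrite Gcst.
  exact: is_derive_cst.
have := etrans (esym (derive_val (is_derive := dG))) (derive_val (is_derive := G0)).
have -> : w0 - s * a0 = x by rewrite /w0; ring.
have -> : y - (k * a0 + c * x) = z by rewrite /y; ring.
have -> : w0 - s * a1 = x - s * (a1 - a0) by rewrite /w0; ring.
have -> : y - (k * a1 + c * (x - s * (a1 - a0))) = z + (c * s - k) * (a1 - a0).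
  by rewrite /y; ring.
move=> H; apply/eqP; rewrite -subr_eq0 -[X in _ == X]H; apply/eqP; ring.
Qed.

End linear_model.

(** * Reduction to the linear model and conclusion *)

Lemma cond_indep_scale (d : measure_display) (T : measurableType d)
    (R : realType) (P : probability T R) (U V W : T -> R) (r : R) :
  cond_indep P U V W -> cond_indep P (fun t => r * U t) V W.
Proof.
move=> ci B1 B2 mB1 mB2.
have mB : measurable [set u | B1 (r * u)].
  rewrite -[X in measurable X]setTI.
  by have mr : measurable_fun setT ( *%R r) by []; exact: mr.
exact: (ci _ _ mB mB2).
Qed.

Theorem theorem1 (d : measure_display) (T : measurableType d) (R : realType)
  (P : probability T R)
  (A EX EH EY X H Y : T -> R) (q b c dd : R) (pEX pE : R -> R) :
  measurable_fun setT A -> measurable_fun setT EX ->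
  measurable_fun setT EH -> measurable_fun setT EY ->
  (forall t, X t = q * A t + EX t) ->
  (forall t, H t = b * A t + EH t) ->
  (forall t, Y t = c * X t + dd * H t + EY t) ->
  mutually_independent4 P A EX EH EY ->
  (exists pA : R -> R, has_density P A pA) ->
  c != 0 -> q * c + b * dd != 0 ->
  has_density P EX pEX -> has_density P (fun t => EY t + dd * EH t) pE ->
  (forall x, 0 < pEX x) -> (forall x, 0 < pE x) ->
  thrice_differentiable (fun x => ln (pEX x)) ->
  thrice_differentiable (fun x => ln (pE x)) ->
  ~ (is_gaussian P EX /\ is_gaussian P (fun t => EY t + dd * EH t)) ->
  forall alpha beta : R, beta != 0 ->
    ~ cond_indep P (fun t => alpha * A t + beta * X t) A Y.
Proof.
move=> mA mEX mEH mEY XE HE YE ind [pA dA] c0 k0 dEX dE pEX0 pE0 f2_3 f3_3.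
move=> not_both alpha beta beta0 ci.
set E := fun t => EY t + dd * EH t in dE not_both.
have mE : measurable_fun setT E by apply: measurable_funD => //; exact: measurable_funM.
pose s := alpha / beta + q; pose k := q * c + b * dd.
pose Am : {mfun T >-> R} := mfun_Sub (mem_set mA).
pose EXm : {mfun T >-> R} := mfun_Sub (mem_set mEX).
pose Em : {mfun T >-> R} := mfun_Sub (mem_set mE).
have {}ci : cond_indep P (fun t => s * A t + EX t) A
    (fun t => k * A t + c * EX t + E t).
  have -> : (fun t => k * A t + c * EX t + E t) = Y.
    by apply/funext => t; rewrite YE XE HE /E /k; ring.
  have -> : (fun t => s * A t + EX t) =
      (fun t => beta^-1 * (alpha * A t + beta * X t)).
    by apply/funext => t; rewrite XE /s; field.
  exact: cond_indep_scale.
have indA B B' : measurable B -> measurable B' ->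
    P (A @^-1` B `&` EX @^-1` B') = (P (A @^-1` B) * P (EX @^-1` B'))%E.
  move=> mB mB'; have := ind B B' setT setT mB mB' measurableT measurableT.
  by rewrite !preimage_setT !setIT probability_setT !mule1.
have indE (S : set (R * R)) B : measurable S -> measurable B ->
    P ([set t | S (A t, EX t)] `&` E @^-1` B) =
    (P [set t | S (A t, EX t)] * P (E @^-1` B))%E.
  move=> mS mB.
  have mS' : measurable [set hy : R * R | B (hy.2 + dd * hy.1)].
    have mg : measurable_fun setT (fun hy : R * R => hy.2 + dd * hy.1).
      by apply: measurable_funD => //; exact: measurable_funM.
    by rewrite -[X in measurable X]setTI; exact: mg.
  exact: (mutually_independent4_pair P A EX EH EY mA mEX mEH mEY ind _ _ mS mS').
have df2 x : derivable (fun x => ln (pEX x)) x 1 by exact: (f2_3 0%N).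
have df3 x : derivable (fun x => ln (pE x)) x 1 by exact: (f3_3 0%N).
have ddf2 x : derivable (derive1 (fun x => ln (pEX x))) x 1 by exact: (f2_3 1%N).
have ddf3 x : derivable (derive1 (fun x => ln (pE x))) x 1 by exact: (f3_3 1%N).
have cont (f : R -> R) : (forall x, derivable f x 1) -> continuous f.
  by move=> df x; apply: differentiable_continuous; exact/derivable1_diffP.
have [a0 sa0] := support_neq0 P A mA.
(* The increments are h = a1 - a0, with [a0] fixed and [a1] running through support points that
   approach it. *)
have prop (x z : R) : s * derive1 (derive1 (fun x => ln (pEX x))) x =
    - (c * (c * s - k)) * derive1 (derive1 (fun x => ln (pE x))) z.
  apply: (second_derivatives_proportional _ _ s c (c * s - k) ddf2 ddf3) => e e0.
  have [a1 [sa1 a10 a1e]] := support_no_isolated_point P A mA pA a0 e dA sa0 e0.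
  exists (a1 - a0); split; [by rewrite subr_eq0|by []|].
  exact: (cond_indep_derivatives P Am EXm Em pEX pE s k c indA indE dEX dE
    pEX0 pE0 (cont _ df2) (cont _ df3) a0 a1 df2 df3 ci sa0 sa1).
have EX_cst kappa := cst_log_second_derivative_gaussian P EX pEX kappa mEX dEX pEX0 f2_3.
have E_cst kappa := cst_log_second_derivative_gaussian P E pE kappa mE dE pE0 f3_3.
(* Here [prop] reads c k f3'' = 0, so f3'' = 0, against the strict negativity of [kappa]. *)
have [s0|s0] := eqVneq s 0.
  have [] := E_cst 0; last by rewrite ltxx.
  move=> z; have /esym/eqP := prop 0 z; rewrite s0 mulr0 mul0r sub0r mulrN opprK.
  by rewrite !mulf_eq0 (negbTE c0) (negbTE k0) => /eqP.
(* Here [prop] reads s f2'' = 0 with [s] nonzero, and [EX_cst] gives the same contradiction. *)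
have [m0|m0] := eqVneq (c * s - k) 0.
  have [] := EX_cst 0; last by rewrite ltxx.
  move=> x; have /eqP := prop x 0; rewrite m0 mulr0 oppr0 mul0r.
  by rewrite mulf_eq0 (negbTE s0) => /eqP.
(* Both coefficients are nonzero: freezing either variable of [prop] at 0 shows that the other
   second derivative is constant. *)
apply: not_both; split.
- apply: (proj2 (EX_cst (s^-1 * (- (c * (c * s - k)) *
    derive1 (derive1 (fun x => ln (pE x))) 0)) _)).
  by move=> x; rewrite -(prop x 0) mulKf.
- apply: (proj2 (E_cst ((- (c * (c * s - k)))^-1 * (s *
    derive1 (derive1 (fun x => ln (pEX x))) 0)) _)).
  by move=> z; rewrite (prop 0 z) mulKf// oppr_eq0 mulf_neq0.
Qed.
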